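(* Let $n>2$, $m\geq 1$, and let $X:\Sigma^n\to\mathbb{R}^{n+m}$ be a complete $\lambda$-soliton for the mean curvature flow (MCF) with respect to $\vec 0\in\mathbb{R}^{n+m}$, with $\lambda\le 0$. Then $\Sigma$ is non-parabolic.
   Context: A complete isometric immersion $X:\Sigma^n\to\mathbb{R}^{n+m}$ of an $n$-dimensional Riemannian manifold is a $\lambda$-soliton for the MCF with respect to $\vec 0$ ($\lambda\in\mathbb{R}$) if $\vec H=-\lambda X^\perp$, where $\vec H$ is the mean curvature vector of $X$ (the trace of the second fundamental form, so $\vec H=\Delta^\Sigma X$) and $X^\perp$ is the component of the position vector $X$ normal to $\Sigma$. A complete Riemannian manifold $M$ is parabolic if every continuous subharmonic function $u:M\to\mathbb{R}$ ($\Delta u\ge 0$ when $u\in C^2$) with $\sup_M u<\infty$ is constant; it is non-parabolic if it is not parabolic. *)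

(* Defs.v *)
From HB Require Import structures.
From mathcomp Require Import all_boot all_order all_algebra.
From mathcomp Require Import all_classical all_reals all_analysis.
Set Implicit Arguments.
Unset Strict Implicit.
Unset Printing Implicit Defensive.
Import Order.TTheory GRing.Theory Num.Theory.
Import numFieldNormedType.Exports.
Local Open Scope classical_set_scope.
Local Open Scope ring_scope.

(* C^k on U, meant for open U.  Since the source is finite dimensional, f is
   C^(k+1) iff it is Frechet differentiable and, for each fixed v, its
   directional derivative x |-> 'D_v f x is C^k. *)
Fixpoint class_C (R : realType) (n : nat) (W : normedModType R) (k : nat)
    (U : set 'rV[R]_n) (f : 'rV[R]_n -> W) {struct k} : Prop :=
  match k with
  | 0%N => forall x, U x -> {for x, continuous f}
  | k'.+1 => (forall x, U x -> differentiable f x) /\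
             (forall v : 'rV[R]_n, class_C k' U (fun x => 'D_v f x))
  end.

Definition smooth_on (R : realType) (n : nat) (W : normedModType R)
    (U : set 'rV[R]_n) (f : 'rV[R]_n -> W) : Prop :=
  forall k, class_C k U f.

Definition partial (R : realType) (n : nat) (W : normedModType R) (i : 'I_n)
    (f : 'rV[R]_n -> W) (x : 'rV[R]_n) : W :=
  'D_(delta_mx 0 i : 'rV[R]_n) f x.

(* A homeomorphism [to] from the open set [dom] onto the open set [cod], with
   inverse [from]; the values of [to] outside [dom] and of [from] outside
   [cod] are irrelevant. *)
Record chart (R : realType) (n : nat) (M : topologicalType) := Chart {
  dom : set M;
  cod : set 'rV[R]_n;
  to : M -> 'rV[R]_n;
  from : 'rV[R]_n -> M;
  open_dom : open dom;
  open_cod : open cod;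
  to_cod : forall p, dom p -> cod (to p);
  from_dom : forall x, cod x -> dom (from x);
  toK : forall p, dom p -> from (to p) = p;
  fromK : forall x, cod x -> to (from x) = x;
  to_continuous : forall p, dom p -> {for p, continuous to};
  from_continuous : forall x, cod x -> {for x, continuous from} }.

Definition transition (R : realType) (n : nat) (M : topologicalType)
    (c c' : chart R n M) (x : 'rV[R]_n) : 'rV[R]_n := to c' (from c x).

Definition overlap (R : realType) (n : nat) (M : topologicalType)
    (c c' : chart R n M) : set 'rV[R]_n := cod c `&` from c @^-1` dom c'.

(* A smooth n-manifold with a Riemannian metric.  [metric c x] is the Gram
   matrix g_ij of the coordinate fields of the chart c at the point with
   coordinates x; [metric_change] is the transformation law of a
   (0,2)-tensor ('J is the Jacobian acting on row vectors: its i-th row is the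
   i-th partial derivative). *)
Record riemannian_manifold (R : realType) (n : nat) := RiemannianManifold {
  carrier :> topologicalType;
  mfd_hausdorff : hausdorff_space carrier;
  mfd_second_countable : @second_countable carrier;
  mfd_nonempty : [set: carrier] !=set0;
  atlas : set (chart R n carrier);
  atlas_cover : forall p : carrier, exists2 c, atlas c & dom c p;
  atlas_smooth : forall c c', atlas c -> atlas c' ->
    smooth_on (overlap c c') (transition c c');
  metric : chart R n carrier -> 'rV[R]_n -> 'M[R]_n;
  metric_smooth : forall c, atlas c -> smooth_on (cod c) (metric c);
  metric_sym : forall c x, atlas c -> cod c x -> (metric c x)^T = metric c x;
  metric_posdef : forall c x (v : 'rV[R]_n), atlas c -> cod c x -> v != 0 ->
    0 < (v *m metric c x *m v^T) 0 0;
  metric_change : forall c c' x, atlas c -> atlas c' -> overlap c c' x ->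
    metric c x = jacobian (transition c c') x
                 *m metric c' (transition c c' x)
                 *m (jacobian (transition c c') x)^T }.

Section Riemannian.
Variables (R : realType) (n : nat) (M : riemannian_manifold R n).
Implicit Types (c : chart R n M) (x : 'rV[R]_n) (u : M -> R).

Definition metric_inv c x : 'M[R]_n := invmx (metric c x).

(* Christoffel symbol Gamma^k_ij of the Levi-Civita connection. *)
Definition christoffel c (k i j : 'I_n) x : R :=
  2^-1 * \sum_(l < n) metric_inv c x k l *
    (partial i (fun y => metric c y j l) x
     + partial j (fun y => metric c y i l) x
     - partial l (fun y => metric c y i j) x).

(* Laplace-Beltrami operator, as the metric trace of the Hessian. *)
Definition laplacian c u x : R :=
  \sum_(i < n) \sum_(j < n) metric_inv c x i j *
    (partial i (partial j (u \o from c)) x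
     - \sum_(k < n) christoffel c k i j x * partial k (u \o from c) x).

Definition is_geodesic (gamma : R -> M) : Prop :=
  continuous gamma /\
  forall c t, atlas c -> dom c (gamma t) ->
    let y : R -> 'rV[R]_n := to c \o gamma in
    [/\ derivable y t 1, derivable (derive1 y) t 1 &
        forall k : 'I_n, derive1 (derive1 y) t 0 k +
          \sum_(i < n) \sum_(j < n)
            christoffel c k i j (y t) * derive1 y t 0 i * derive1 y t 0 j = 0].

(* Geodesic completeness: every initial position p and velocity v is realised
   by a geodesic defined for all times. *)
Definition complete_manifold : Prop :=
  forall c (p : M) (v : 'rV[R]_n), atlas c -> dom c p ->
    exists gamma : R -> M,
      [/\ is_geodesic gamma, gamma 0 = p & derive1 (to c \o gamma : R -> 'rV[R]_n) 0 = v].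

Definition harmonic_on (O : set M) (h : M -> R) : Prop :=
  forall c, atlas c ->
    class_C 2 (cod c `&` from c @^-1` O) (h \o from c : 'rV[R]_n -> R) /\
    forall x, cod c x -> O (from c x) -> laplacian c h x = 0.

(* Continuous subharmonic functions, in the classical sense of comparison with
   harmonic functions on relatively compact domains; for C^2 functions this
   amounts to a nonnegative Laplacian.  Domains without boundary (the compact
   components of M) are excluded, as there is nothing to compare there. *)
Definition subharmonic u : Prop :=
  continuous u /\
  forall (O : set M) (h : M -> R),
    open O -> connected O -> compact (closure O) ->
    closure O `\` O !=set0 ->
    {within closure O, continuous h} -> harmonic_on O h ->
    (forall p, (closure O `\` O) p -> u p <= h p) ->
    forall p, O p -> u p <= h p.

Definition parabolic : Prop :=
  forall u, subharmonic u -> (exists C : R, forall p, u p <= C) ->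
    exists a : R, forall p, u p = a.

Definition non_parabolic : Prop := ~ parabolic.

Section Immersion.
Variables (N : nat) (X : M -> 'rV[R]_N).

(* Row i is the i-th coordinate tangent vector of the immersion. *)
Definition tangent_frame c x : 'M[R]_(n, N) :=
  \matrix_(i < n) partial i (X \o from c : 'rV[R]_n -> 'rV[R]_N) x.

Definition isometric_immersion : Prop :=
  forall c, atlas c ->
    smooth_on (cod c) (X \o from c : 'rV[R]_n -> 'rV[R]_N) /\
    forall x, cod c x ->
      row_free (tangent_frame c x) /\
      metric c x = tangent_frame c x *m (tangent_frame c x)^T.

(* Normal component of w at the point of coordinates x: projection onto the
   orthogonal complement {u | u *m T^T = 0} of the tangent space (the row
   space of the frame T), along the tangent space. *)
Definition normal_part c x (w : 'rV[R]_N) : 'rV[R]_N :=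
  w *m proj_mx (kermx (tangent_frame c x)^T) <<tangent_frame c x>>%MS.

Definition second_fundamental_form c x (i j : 'I_n) : 'rV[R]_N :=
  normal_part c x
    (partial i (partial j (X \o from c : 'rV[R]_n -> 'rV[R]_N)) x).

Definition mean_curvature c x : 'rV[R]_N :=
  \sum_(i < n) \sum_(j < n)
    metric_inv c x i j *: second_fundamental_form c x i j.

Definition mcf_soliton (lambda : R) : Prop :=
  [/\ complete_manifold, isometric_immersion &
      forall c x, atlas c -> cod c x ->
        mean_curvature c x = - lambda *: normal_part c x (X (from c x))].

End Immersion.
End Riemannian.

(* Main.v *)
(* The function u = - (1 + |X|^2)^(-1/2) is bounded above by 0 and strictly
   subharmonic.  By Gauss' formula the Laplacian of s = |X|^2 is
   2n + 2<H, X> = 2n - 2 lambda |X^perp|^2 >= 2n, while |grad s|^2 = 4 |X^T|^2 <= 4 s.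
   With F(t) = - (1 + t)^(-1/2), so F' = (1 + t)^(-3/2) / 2 and
   F'' = - 3/4 (1 + t)^(-5/2), and n >= 3,
     Laplacian(F(s)) = F'(s) Laplacian(s) + F''(s) |grad s|^2
                    >= 3 (1 + s)^(-3/2) - 3 s (1 + s)^(-5/2) = 3 (1 + s)^(-5/2) > 0.
   If h is harmonic, u - h therefore has no interior local maximum: at such a
   point the Laplacian of u would be at most that of h, which is 0.  This gives
   the comparison with harmonic functions and, with h = 0, that u is not
   constant. *)
Require Import Defs.
From mathcomp Require Import all_boot all_order all_algebra.
From mathcomp Require Import all_classical all_reals all_analysis.
From mathcomp Require Import ring lra.
Set Implicit Arguments.
Unset Strict Implicit.
Unset Printing Implicit Defensive.
Import Order.TTheory GRing.Theory Num.Theory.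
Import numFieldNormedType.Exports.
Local Open Scope classical_set_scope.
Local Open Scope ring_scope.

(** * Derivatives near a point and along a line *)

Lemma near_eq_differentiable (R : numFieldType) (V W : normedModType R)
    (f g : V -> W) (x : V) :
  (\near x, f x = g x) -> differentiable g x -> differentiable f x.
Proof.
move=> fg dg.
have gc : continuous ('d g x) by apply: diff_continuous.
have fxg : f x = g x by apply: (nbhs_singleton fg).
(* The first-order expansion depends only on the germ, so ['d g x] expands [f] too; [diff_unique]
   then identifies it as the differential of [f]. *)
have E : f \o shift x = cst (f x) + 'd g x +o_ 0 id.
  apply/eqaddoP => e e0.
  have := diff_locally dg => /eqaddoP /(_ e e0).
  move: fg; rewrite (near_shift 0) subr0 => fg; apply: filterS2 fg => h.
  by rewrite /= -!/((_ + _) h) !fctE /= fxg => ->.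
apply/diff_locallyP; rewrite (diff_unique gc E); split => //.
Qed.

Section Line.
Variables (R : numFieldType) (V W : normedModType R).

(** Both sides have the same difference quotient. This reduces directional derivatives to
    one-variable calculus, where the mean value theorem applies. *)
Lemma is_derive_line (f : V -> W) (x v : V) (t : R) :
  derivable f (x + t *: v) v ->
  is_derive t 1 (fun s : R => f (x + s *: v)) ('D_v f (x + t *: v)).
Proof.
move=> df.
have E : (fun h : R => h^-1 *: (((fun s : R => f (x + s *: v)) \o shift t) (h *: 1)
           - f (x + t *: v)))
       = (fun h : R => h^-1 *: ((f \o shift (x + t *: v)) (h *: v) - f (x + t *: v))).
  apply/funext => h /=; congr (_ *: (f _ - _)).
  by rewrite [h *: 1]mulr1 scalerDl addrCA.
by split; rewrite ?/derivable ?/derive E.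
Qed.

End Line.

(** * Maxima and mixed derivatives *)

Section LocalMax.
Variable R : realType.

Lemma local_max_derive1 (f : R -> R) (a : R) :
  (\forall t \near a, f t <= f a) -> (\forall t \near a, derivable f t 1) ->
  'D_1 f a = 0.
Proof.
move=> fa df.
have /nbhs_ballP[e /= e0 He] : \forall t \near a, f t <= f a /\ derivable f t 1.
  by apply: filterS2 fa df.
have inb t : t \in `]a - e, a + e[ -> ball a e t.
  by rewrite in_itv /= => /andP[h1 h2]; rewrite /ball /= ltr_norml; lra.
have a0 : a \in `]a - e, a + e[ by rewrite in_itv /=; lra.
have leab : a - e <= a + e by lra.
have [] // := @derive1_at_max R f _ _ a leab _ a0.
  by move=> t /inb /He[].
by move=> t /inb /He[].
Qed.

(** Since the first derivative vanishes at [a], a positive second derivative would make it positive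
    just to the right of [a]; the mean value theorem then gives a value larger than [f a] nearby. *)
Lemma local_max_derive2 (f : R -> R) (a : R) :
  (\forall t \near a, f t <= f a) -> (\forall t \near a, derivable f t 1) ->
  derivable (fun t => 'D_1 f t) a 1 -> 'D_1 (fun t => 'D_1 f t) a <= 0.
Proof.
move=> fa df ddf; rewrite leNgt; apply/negP => d0.
have D0 := local_max_derive1 fa df.
have : \forall h \near 0^',
    0 < h^-1 *: (((fun t => 'D_1 f t) \o shift a) (h *: 1) - 'D_1 f a).
  exact: (cvgr_gt _ ddf _ d0).
rewrite near_withinE => /nbhs_ballP[e1 /= e10 H1].
have /nbhs_ballP[e2 /= e20 H2] : \forall t \near a, f t <= f a /\ derivable f t 1.
  by apply: filterS2 fa df.
(* Half of [e] is used below, so that the closed interval from [a] to [a + e / 2] lies inside both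
   open balls. *)
pose e := Num.min e1 e2.
have e0 : 0 < e by rewrite lt_min e10.
have [ee1 ee2] : e <= e1 /\ e <= e2 by rewrite !ge_min !lexx orbT.
have inb t : a <= t <= a + e / 2 -> ball a e2 t.
  by move=> /andP[h1 h2]; rewrite /ball /= ltr_norml; lra.
have [|||c] := @MVT R f (fun t => 'D_1 f t) a (a + e / 2).
- by lra.
- move=> t; rewrite in_itv /= => /andP[t1 t2]; apply: derivableP.
  by have [] := H2 t (inb t _) => //; lra.
- apply: derivable_within_continuous => t; rewrite in_itv /= => /andP[t1 t2].
  by have [] := H2 t (inb t _) => //; lra.
rewrite in_itv /= => /andP[c1 c2] E.
have : 0 < (c - a)^-1 *: (((fun t => 'D_1 f t) \o shift a) ((c - a) *: 1) - 'D_1 f a).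
  apply: H1; last by rewrite subr_eq0 gt_eqF.
  by rewrite /ball /= ltr_norml; lra.
rewrite /= [_ *: 1]mulr1 subrK D0 subr0 => P.
have Dc : 0 < 'D_1 f c.
  by move: P; rewrite -[_ *: _]/(_ * _) pmulr_rgt0 // invr_gt0 subr_gt0.
have : 0 < f (a + e / 2) - f a by rewrite E mulr_gt0 //; lra.
have /inb/H2[h _] : a <= a + e / 2 <= a + e / 2 by lra.
lra.
Qed.

End LocalMax.

Section SecondOrder.
Variables (R : realType) (V : normedModType R).

Lemma near_line (x b : V) (P : V -> Prop) :
  (\forall y \near x, P y) -> \forall t \near (0 : R), P (x + t *: b).
Proof.
move=> Px.
have : (fun t : R => x + t *: b) @ (0 : R) --> x.
  rewrite -[X in _ --> X]addr0 -[X in _ + X](scale0r b).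
  apply: cvgD; first exact: cvg_cst.
  by apply: cvgZr_tmp; exact: cvg_id.
by apply.
Qed.

(** Restriction to the line through [x] in direction [b] turns this into the one-variable test at
    0. *)
Lemma second_derivative_test (w : V -> R) (x b : V) :
  (\forall y \near x, w y <= w x) -> (\forall y \near x, differentiable w y) ->
  derivable (fun y => 'D_b w y) x b ->
  'D_b w x = 0 /\ 'D_b (fun y => 'D_b w y) x <= 0.
Proof.
move=> wx dw ddw.
pose f (t : R) := w (x + t *: b).
have f0 : \forall t \near (0 : R), f t <= f 0.
  by apply: filterS (near_line b wx) => s; rewrite /f scale0r addr0.
have line_der y : differentiable w y -> derivable w y b by exact: diff_derivable.
have fD : \forall t \near (0 : R), is_derive (t : R) 1 f ('D_b w (x + t *: b)).
  apply: filterS (near_line b dw) => s ds.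
  exact/is_derive_line/line_der.
have df : \forall t \near (0 : R), derivable f t 1 by apply: filterS fD => t [].
have D0 : 'D_1 f 0 = 'D_b w x.
  by have [_ ->] := nbhs_singleton fD; rewrite scale0r addr0.
have E : \forall t \near (0 : R), (fun s => 'D_b w (x + s *: b)) t = 'D_1 f t.
  by apply: filterS fD => t [_ ->].
have I : is_derive (0 : R) 1 (fun s => 'D_b w (x + s *: b)) ('D_b (fun y => 'D_b w y) x).
  have := @is_derive_line R V R (fun y => 'D_b w y) x b 0.
  by rewrite scale0r addr0; apply.
have [I1 I2] := near_eq_is_derive E I.
split; first by rewrite -D0; exact: local_max_derive1.
by rewrite -I2; exact: local_max_derive2.
Qed.

End SecondOrder.

(** * Symmetry of mixed second derivatives *)

Section Schwarz.
Variables (R : realType) (V : normedModType R).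

(** Two applications of the mean value theorem: first in [s], to the increment of [f] across
    [h *: v], then in [t], to ['D_u f] along [v]. *)
Lemma second_difference (f : V -> R) (x u v : V) (h : R) : 0 < h ->
  (forall s t, 0 <= s <= h -> 0 <= t <= h ->
     derivable f (x + s *: u + t *: v) u /\
     derivable (fun y => 'D_u f y) (x + s *: u + t *: v) v) ->
  exists s t, [/\ 0 <= s <= h, 0 <= t <= h &
    'D_v (fun y => 'D_u f y) (x + s *: u + t *: v) =
    ((f (x + h *: u + h *: v) - f (x + h *: u)) - (f (x + h *: v) - f x)) / (h * h)].
Proof.
move=> h0 H.
pose g (s : R) := f ((x + h *: v) + s *: u) - f (x + s *: u).
pose dg (s : R) := 'D_u f ((x + h *: v) + s *: u) - 'D_u f (x + s *: u).
have gD s : 0 <= s <= h -> is_derive (s : R) 1 g (dg s).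
  move=> sh; apply: is_deriveB; apply: is_derive_line.
    by rewrite addrAC; apply: (H _ _ _ _).1 => //; lra.
  by rewrite -[x + _]addr0 -(scale0r v); apply: (H _ _ _ _).1 => //; lra.
have [||s] := @MVT R g dg 0 h h0.
- by move=> s /[!in_itv]/= sh; apply: gD; lra.
- apply: derivable_within_continuous => s; rewrite in_itv /= => sh.
  by have [] := gD s sh.
rewrite in_itv /= subr0 => sh gE.
have {}sh : 0 <= s <= h by lra.
pose k (t : R) := 'D_u f ((x + s *: u) + t *: v).
pose dk (t : R) := 'D_v (fun y => 'D_u f y) ((x + s *: u) + t *: v).
have kD t : 0 <= t <= h -> is_derive (t : R) 1 k (dk t).
  by move=> th; apply: is_derive_line; apply: (H _ _ _ _).2.
have [||t] := @MVT R k dk 0 h h0.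
- by move=> t /[!in_itv]/= th; apply: kD; lra.
- apply: derivable_within_continuous => t; rewrite in_itv /= => th.
  by have [] := kD t th.
rewrite in_itv /= subr0 => th kE.
exists s, t; split => //; first by lra.
rewrite -/(dk t).
have E : dg s = dk t * h by rewrite -kE /k /dg scale0r addr0 addrAC.
rewrite (addrAC x (h *: u)) -[f _ - _ - _]/(g h - (f (x + h *: v) - f x)).
have -> : f (x + h *: v) - f x = g 0 by rewrite /g !scale0r !addr0.
by rewrite gE E -[dk t * h * h]mulrA mulfK // mulf_neq0 // gt_eqF.
Qed.

(* Both mixed derivatives are limits of the same second difference quotient. *)
Lemma derive_comm (f : V -> R) (x u v : V) :
  (\forall y \near x, derivable f y u /\ derivable f y v) ->
  (\forall y \near x, derivable (fun z => 'D_u f z) y v) ->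
  (\forall y \near x, derivable (fun z => 'D_v f z) y u) ->
  {for x, continuous (fun y => 'D_v (fun z => 'D_u f z) y)} ->
  {for x, continuous (fun y => 'D_u (fun z => 'D_v f z) y)} ->
  'D_v (fun z => 'D_u f z) x = 'D_u (fun z => 'D_v f z) x.
Proof.
move=> df duv dvu cuv cvu; apply/eqP; rewrite -subr_eq0 -normr_le0.
apply/ler_addgt0Pl => e e0; rewrite addr0.
have e20 : 0 < e / 2 by lra.
have tri (a b c : R) : `|a - c| <= e / 2 -> `|b - c| <= e / 2 -> `|a - b| <= e.
  move=> ac bc; rewrite -(subrKA c) (le_trans (ler_normD _ _)) // (splitr e).
  by rewrite lerD // distrC.
have /cvgrPdist_le /(_ _ e20) Huv := cuv.
have /cvgrPdist_le /(_ _ e20) Hvu := cvu.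
have [r /= r0 Hr] := (nbhs_ballP _ _).1
  (filterI (filterI df duv) (filterI dvu (filterI Huv Hvu))).
(* With this size the whole parallelogram spanned by [h *: u] and [h *: v] at [x] stays in the ball
   of radius [r]; the added 1 keeps the denominator positive when [u] and [v] vanish. *)
pose h := r / (`|u| + `|v| + 1).
have D0 : 0 < `|u| + `|v| + 1 by rewrite ltr_wpDl // addr_ge0.
have h0 : 0 < h by rewrite divr_gt0.
have inb s t : 0 <= s <= h -> 0 <= t <= h -> ball x r (x + s *: u + t *: v).
  move=> /andP[s0 sh] /andP[t0 th]; rewrite -ball_normE /ball_ /= -addrA opprD addNKr.
  rewrite normrN (le_lt_trans (ler_normD _ _)) // !normrZ !ger0_norm //.
  apply: (@le_lt_trans _ _ (h * (`|u| + `|v|))).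
    by rewrite mulrDr lerD // ler_wpM2r.
  by rewrite /h mulrAC ltr_pdivrMr // ltr_pM2l // ltrDl.
have [|s [t [sh th E1]]] := @second_difference f x u v h h0.
  by move=> s t sh th; have [[[? ?] ?] [? [? ?]]] := Hr _ (inb s t sh th).
have [|s' [t' [sh' th' E2]]] := @second_difference f x v u h h0.
  move=> s' t' sh' th'; rewrite addrAC.
  by have [[[? ?] ?] [? [? ?]]] := Hr _ (inb t' s' th' sh').
have [_ [_ [/= P1 _]]] := Hr _ (inb s t sh th).
have [_ [_ [_ /= P2]]] := Hr _ (inb t' s' th' sh').
rewrite (addrAC x) in P2.
(* The second difference is symmetric in [u] and [v], so the two intermediate values coincide
   although they are taken at different points; each is within [e / 2] of its value at [x]. *)
have E : 'D_v (fun y => 'D_u f y) (x + s *: u + t *: v) =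
         'D_u (fun y => 'D_v f y) (x + s' *: v + t' *: u).
  rewrite E1 E2 (addrAC x (h *: v)); congr (_ / _).
  by ring.
rewrite E in P1; exact: tri P1 P2.
Qed.

End Schwarz.

(** * Hessians at a local maximum *)

Section Directional.
Variables (R : realType) (n : nat).

Lemma derive_partial (W : normedModType R) (f : 'rV[R]_n -> W) (x b : 'rV[R]_n) :
  differentiable f x -> 'D_b f x = \sum_(i < n) b 0 i *: partial i f x.
Proof.
move=> df; rewrite deriveE // {1}(row_sum_delta b) linear_sum /=.
by apply: eq_bigr => i _; rewrite linearZ /partial deriveE.
Qed.

(** The double sum is the second derivative of [w] in direction [b], expanded in partial
    derivatives. *)
Lemma local_max_hessian (w : 'rV[R]_n -> R) (x b : 'rV[R]_n) :
  (\forall y \near x, w y <= w x) -> (\forall y \near x, differentiable w y) ->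
  (forall j, differentiable (partial j w) x) ->
  \sum_(i < n) \sum_(j < n) (b 0 i * b 0 j) * partial i (partial j w) x <= 0.
Proof.
move=> wx dw ddw.
have E : \forall y \near x, 'D_b w y = (\sum_(j < n) (b 0 j *: partial j w)) y.
  apply: filterS dw => y /derive_partial ->.
  by rewrite fct_sumE.
have dS : differentiable (\sum_(j < n) (b 0 j *: partial j w)) x.
  by apply: differentiable_sum => j; exact: differentiableZ.
have dD : derivable (fun y => 'D_b w y) x b.
  by apply: diff_derivable; apply: near_eq_differentiable dS.
have [_] := second_derivative_test wx dw dD.
rewrite (near_eq_derive _ E) derive_sum; last first.
  by move=> j; apply: diff_derivable; exact: differentiableZ.
rewrite exchange_big /=; congr (_ <= _); apply: eq_bigr => j _.
rewrite deriveZ; last exact: diff_derivable.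
rewrite derive_partial // scaler_sumr; apply: eq_bigr => i _.
by rewrite scalerA [b 0 j * _]mulrC.
Qed.

(** [B *m B^T] is the sum of the rank-one matrices of the columns of [B], and each column
    contributes a nonpositive second directional derivative. No diagonalisation is involved. *)
Lemma local_max_trace_hessian (m : nat) (B : 'M[R]_(n, m)) (w : 'rV[R]_n -> R)
    (x : 'rV[R]_n) :
  (\forall y \near x, w y <= w x) -> (\forall y \near x, differentiable w y) ->
  (forall j, differentiable (partial j w) x) ->
  \sum_(i < n) \sum_(j < n) (B *m B^T) i j * partial i (partial j w) x <= 0.
Proof.
move=> wx dw ddw.
have H (a : 'I_m) := local_max_hessian (col a B)^T wx dw ddw.
suff -> : \sum_(i < n) \sum_(j < n) (B *m B^T) i j * partial i (partial j w) x =
  \sum_(a < m) \sum_(i < n) \sum_(j < n)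
    ((col a B)^T 0 i * (col a B)^T 0 j) * partial i (partial j w) x.
  exact: sumr_le0.
rewrite [RHS]exchange_big /=; apply: eq_bigr => i _.
rewrite [RHS]exchange_big /=; apply: eq_bigr => j _.
rewrite mxE mulr_suml; apply: eq_bigr => a _.
by rewrite !mxE.
Qed.

Lemma local_max_partial (w : 'rV[R]_n -> R) (x : 'rV[R]_n) (k : 'I_n) :
  (\forall y \near x, w y <= w x) -> (\forall y \near x, differentiable w y) ->
  differentiable (partial k w) x -> partial k w x = 0.
Proof.
move=> wx dw ddw; rewrite /partial.
by have [] := second_derivative_test wx dw (@diff_derivable _ _ _ _ _ (delta_mx 0 k) ddw).
Qed.

End Directional.

(** * Normal projection *)

Section NormalProjection.
Variables (R : realFieldType) (n N : nat) (T : 'M[R]_(n, N)).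

Definition dot (a b : 'rV[R]_N) : R := (a *m b^T) 0 0.

Lemma dotE a b : dot a b = \sum_j a 0 j * b 0 j.
Proof. by rewrite /dot mxE; apply: eq_bigr => j _; rewrite mxE. Qed.

Lemma dotC a b : dot a b = dot b a.
Proof. by rewrite !dotE; apply: eq_bigr => j _; rewrite mulrC. Qed.

Lemma dotBl a b c : dot (a - b) c = dot a c - dot b c.
Proof. by rewrite /dot mulmxBl !mxE. Qed.

Lemma dotZl k a b : dot (k *: a) b = k * dot a b.
Proof. by rewrite /dot -scalemxAl mxE. Qed.

Lemma dot_suml (I : finType) (a : I -> 'rV[R]_N) b :
  dot (\sum_i a i) b = \sum_i dot (a i) b.
Proof. by rewrite /dot mulmx_suml summxE. Qed.

Lemma dot_ge0 a : 0 <= dot a a.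
Proof. by rewrite dotE sumr_ge0 // => j _; rewrite -expr2 sqr_ge0. Qed.

Lemma dot_eq0 a : dot a a = 0 -> a = 0.
Proof.
rewrite dotE => /eqP; rewrite psumr_eq0 => [/allP H|j _]; last by rewrite -expr2 sqr_ge0.
apply/rowP => j; have := H j (mem_index_enum j).
by rewrite /= mulf_eq0 orbb mxE => /eqP.
Qed.

Lemma gram_sym i j : (T *m T^T) i j = (T *m T^T) j i.
Proof. by rewrite -[in LHS](trmxK (T *m T^T)) mxE trmx_mul trmxK. Qed.

Hypothesis freeT : row_free T.
Let G := T *m T^T.

Lemma gram_mul_eq0 (v : 'rV[R]_n) : v *m G = 0 -> v = 0.
Proof.
move=> vG; apply/eqP; rewrite -(mulmx_free_eq0 v freeT); apply/eqP/dot_eq0.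
by rewrite /dot trmx_mul mulmxA -(mulmxA v) vG mul0mx mxE.
Qed.

Lemma gram_unit : G \in unitmx.
Proof.
rewrite -row_free_unit -kermx_eq0; apply/rowV0P => v /sub_kermxP.
exact: gram_mul_eq0.
Qed.

Lemma gram_inv_sym : (invmx G)^T = invmx G.
Proof. by rewrite trmx_inv trmx_mul trmxK. Qed.

(** This is the factorised form that the trace test at a local maximum requires. *)
Lemma gram_invE : invmx G = (invmx G *m T) *m (invmx G *m T)^T.
Proof.
by rewrite trmx_mul gram_inv_sym mulmxA -(mulmxA _ T) mulVmx ?mul1mx // gram_unit.
Qed.

(** The subtracted term lies in the row space of [T] and the remainder is killed by [T^T]; these two
    spaces meet trivially because the Gram matrix is injective. *)
Lemma proj_normalE (w : 'rV[R]_N) :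
  w *m proj_mx (kermx T^T) <<T>>%MS = w - w *m T^T *m invmx G *m T.
Proof.
set q := _ *m T.
have cap0 : (kermx T^T :&: <<T>>)%MS = 0.
  apply/eqP/rowV0P => v; rewrite sub_capmx genmxE => /andP[/sub_kermxP vT].
  move=> /submxP[a va]; move: vT; rewrite va -mulmxA => /gram_mul_eq0 ->.
  by rewrite mul0mx.
have pK : (w - q <= kermx T^T)%MS.
  apply/sub_kermxP; rewrite mulmxBl /q -(mulmxA _ T) -[T *m _]/G.
  by rewrite mulmxKV ?gram_unit // subrr.
have qT : (q <= <<T>>)%MS by rewrite genmxE submxMl.
by rewrite -{1}(subrK q w) mulmxDl (proj_mx_id cap0 pK) (proj_mx_0 cap0 qT) addr0.
Qed.

(** The normal part is orthogonal to the tangential part. This identity gives both the sign of the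
    mean curvature term and the gradient bound. *)
Lemma dot_normal (w : 'rV[R]_N) :
  let p := w - w *m T^T *m invmx G *m T in dot p w = dot p p.
Proof.
move=> p; have pT : p *m T^T = 0.
  by rewrite /p mulmxBl -(mulmxA _ T) -[T *m _]/G mulmxKV ?gram_unit // subrr.
rewrite -{1}(subrK (w *m T^T *m invmx G *m T) w) -/p /dot linearD /= mulmxDr.
by rewrite trmx_mul mulmxA pT mul0mx addr0.
Qed.

End NormalProjection.

(** * Calculus of inner products *)

Section DotDerive.
Variables (R : realType) (V : normedModType R) (N : nat).

Lemma derivable_row (f : V -> 'rV[R]_N) x v a :
  derivable f x v -> derivable (fun y => f y 0 a) x v.
Proof. by move=> /derivable_mxP. Qed.

Lemma derive_row (f : V -> 'rV[R]_N) x v a :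
  derivable f x v -> 'D_v (fun y => f y 0 a) x = ('D_v f x) 0 a.
Proof. by move=> df; rewrite derive_mx // mxE. Qed.

Lemma differentiable_row (f : V -> 'rV[R]_N) x a :
  differentiable f x -> differentiable (fun y => f y 0 a) x.
Proof.
move=> df; have := @differentiable_comp _ _ _ _ f (fun M : 'rV[R]_N => M 0 a) x df.
by apply; exact: differentiable_coord.
Qed.

Lemma dot_fctE (f g : V -> 'rV[R]_N) :
  (fun y => dot (f y) (g y)) =
  \sum_(a < N) ((fun y => f y 0 a) * (fun y => g y 0 a)).
Proof. by apply/funext => y; rewrite fct_sumE dotE. Qed.

Lemma is_derive_dot (f g : V -> 'rV[R]_N) x v :
  derivable f x v -> derivable g x v ->
  is_derive x v (fun y => dot (f y) (g y))
    (dot ('D_v f x) (g x) + dot (f x) ('D_v g x)).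
Proof.
move=> df dg; rewrite dot_fctE.
have fg a : is_derive x v ((fun y => f y 0 a) * (fun y => g y 0 a))
    (f x 0 a * ('D_v g x) 0 a + g x 0 a * ('D_v f x) 0 a).
  apply: is_deriveM; split; by [exact: derivable_row | exact: derive_row].
apply: (is_derive_eq (is_derive_sum fg)); rewrite big_split /= addrC !dotE; congr (_ + _).
by apply: eq_bigr => a _; rewrite mulrC.
Qed.

Lemma differentiable_dot (f g : V -> 'rV[R]_N) x :
  differentiable f x -> differentiable g x ->
  differentiable (fun y => dot (f y) (g y)) x.
Proof.
move=> df dg; rewrite dot_fctE; apply: differentiable_sum => a.
by apply: differentiableM; exact: differentiable_row.
Qed.

Lemma derive_comp1 (f : R -> R) (s : V -> R) x v :
  differentiable s x -> derivable f (s x) 1 ->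
  differentiable (f \o s) x /\ 'D_v (f \o s) x = 'D_1 f (s x) * 'D_v s x.
Proof.
move=> ds /derivable1_diffP df.
have dfs : differentiable (f \o s) x by exact: differentiable_comp.
split=> //; rewrite !deriveE // diff_comp //= -[X in 'd f _ X]mulr1.
by rewrite [LHS]linearZ /= mulrC.
Qed.

End DotDerive.

(** * Immersed submanifolds *)

Section Immersed.
Variables (R : realType) (n N : nat) (M : riemannian_manifold R n).
Variables (X : M -> 'rV[R]_N) (isoX : isometric_immersion X).
Variables (c : chart R n M) (x : 'rV[R]_n) (atc : atlas c) (cx : cod c x).

Let Y : 'rV[R]_n -> 'rV[R]_N := X \o from c.
Let T := tangent_frame X c x.
Let S i j := partial i (partial j Y) x.
Let Gi := metric_inv c x.

Lemma near_cod : \forall y \near x, cod c y.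
Proof. by have := @open_cod _ _ _ c; rewrite openE => /(_ x cx). Qed.

Lemma immersion_differentiable y : cod c y -> differentiable Y y.
Proof. by move=> cy; have [/(_ 1%N)[/(_ y cy)]] := isoX atc. Qed.

Lemma immersion_differentiable1 v y : cod c y ->
  differentiable (fun z => 'D_v Y z) y.
Proof. by move=> cy; have [/(_ 2)[_ /(_ v)[/(_ y cy)]]] := isoX atc. Qed.

Lemma immersion_differentiable2 u v y : cod c y ->
  differentiable (fun z => 'D_u (fun z => 'D_v Y z) z) y.
Proof.
by move=> cy; have [/(_ 3)[_ /(_ v)[_ /(_ u)[/(_ y cy)]]]] := isoX atc.
Qed.

Let dY y (cy : cod c y) v : derivable Y y v.
Proof. exact/diff_derivable/immersion_differentiable. Qed.
Arguments dY {y} cy v.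

Let d1Y y (cy : cod c y) u v : derivable (fun z => 'D_v Y z) y u.
Proof. exact/diff_derivable/immersion_differentiable1. Qed.
Arguments d1Y {y} cy u v.

(** Symmetry of mixed derivatives applied to each component of the immersion; its third-order
    smoothness makes the second derivatives continuous. *)
Lemma hessian_comm i j : S i j = S j i.
Proof.
apply/rowP => a; rewrite /S /partial.
set u : 'rV[R]_n := delta_mx 0 i; set v : 'rV[R]_n := delta_mx 0 j.
have E (w : 'rV[R]_n) : \forall y \near x, 'D_w (fun z => Y z 0 a) y = ('D_w Y y) 0 a.
  by apply: filterS near_cod => y cy; rewrite derive_row //; exact: dY.
have E2 (w w' : 'rV[R]_n) : \forall y \near x,
    'D_w' (fun z => 'D_w (fun z => Y z 0 a) z) y = ('D_w' (fun z => 'D_w Y z) y) 0 a.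
  (* [near_join] yields the germ identity around every nearby [y], so it can be differentiated again
     at [y]. *)
  apply: filterS2 near_cod (near_join (E w)) => y cy Ey.
  by rewrite (near_eq_derive _ Ey) derive_row //; exact: d1Y.
have dd (w w' : 'rV[R]_n) : \forall y \near x,
    derivable (fun z => 'D_w (fun z => Y z 0 a) z) y w'.
  apply: filterS2 near_cod (near_join (E w)) => y cy Ey.
  have H := derivable_row (a := a) (d1Y cy w' w).
  apply: near_eq_derivable H.
  by apply: filterS Ey => z ->.
have cc (w w' : 'rV[R]_n) :
    {for x, continuous (fun y => 'D_w' (fun z => 'D_w (fun z => Y z 0 a) z) y)}.
  have Ew := E2 w w'.
  apply: differentiable_continuous; apply: near_eq_differentiable Ew _.
  exact/differentiable_row/immersion_differentiable2.
have d1 : \forall y \near x,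
    derivable (fun z => Y z 0 a) y v /\ derivable (fun z => Y z 0 a) y u.
  by apply: filterS near_cod => y cy; split; apply: derivable_row; exact: dY.
rewrite -[LHS](nbhs_singleton (E2 v u)) -[RHS](nbhs_singleton (E2 u v)).
exact: derive_comm d1 (dd v u) (dd u v) (cc v u) (cc u v).
Qed.

Lemma rowT i : row i T = partial i Y x.
Proof. by rewrite rowK. Qed.

Lemma metricE y : cod c y -> metric c y = tangent_frame X c y *m (tangent_frame X c y)^T.
Proof. by move=> cy; have [_ /(_ y cy)[]] := isoX atc. Qed.

Lemma metric_entryE y i j : cod c y -> metric c y i j = dot (partial i Y y) (partial j Y y).
Proof.
move=> cy; rewrite metricE // mxE dotE.
by apply: eq_bigr => a _; rewrite !mxE.
Qed.

Lemma tangent_frame_free : row_free T.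
Proof. by have [_ /(_ x cx)[]] := isoX atc. Qed.

Lemma partial_metric i j k :
  partial k (fun y => metric c y i j) x =
  dot (S k i) (partial j Y x) + dot (partial i Y x) (S k j).
Proof.
have E : \forall y \near x, metric c y i j = dot (partial i Y y) (partial j Y y).
  by apply: filterS near_cod => y; exact: metric_entryE.
rewrite /partial (near_eq_derive _ E).
by have [] := is_derive_dot (d1Y cx (delta_mx 0 k) (delta_mx 0 i))
  (d1Y cx (delta_mx 0 k) (delta_mx 0 j)).
Qed.

(** The algebra of the Koszul formula: [a] stands for the product of [S i j] with the [l]-th tangent
    vector, while the products [b] and [d] cancel. *)
Lemma christoffel_cancel (p1 p2 p3 a b d g : R) :
  p1 = a + b -> p2 = a + d -> p3 = b + d -> 2^-1 * (g * (p1 + p2 - p3)) = a * g.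
Proof. by move=> -> -> ->; field. Qed.

(** The Christoffel symbols are the coordinates, in the tangent frame, of the tangential part of
    [S i j]. *)
Lemma christoffelE k i j :
  christoffel c k i j x = (S i j *m T^T *m Gi) 0 k.
Proof.
have GiE : Gi = invmx (T *m T^T) by rewrite /Gi /metric_inv metricE.
rewrite /christoffel mxE mulr_sumr; apply: eq_bigr => l _.
have -> : Gi k l = Gi l k by rewrite GiE -[in LHS]gram_inv_sym mxE.
have -> : (S i j *m T^T) 0 l = dot (S i j) (partial l Y x).
  rewrite mxE dotE; apply: eq_bigr => a _.
  by rewrite !mxE.
apply: christoffel_cancel; first exact: partial_metric.
  by rewrite partial_metric hessian_comm.
by rewrite partial_metric [in LHS]dotC (hessian_comm l i) (hessian_comm l j).
Qed.

Lemma gauss_formula i j : second_fundamental_form X c x i j =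
  S i j - \sum_(k < n) christoffel c k i j x *: partial k Y x.
Proof.
rewrite /second_fundamental_form /normal_part proj_normalE ?tangent_frame_free //.
congr (_ - _); rewrite -/T mulmx_sum_row; apply: eq_bigr => k _.
by rewrite christoffelE /Gi /metric_inv metricE // rowT.
Qed.

Lemma normal_partE w :
  normal_part X c x w = w - w *m T^T *m Gi *m T.
Proof.
by rewrite /normal_part proj_normalE ?tangent_frame_free // /Gi /metric_inv metricE.
Qed.

Definition sqnorm (p : M) : R := dot (X p) (X p).

Let s : 'rV[R]_n -> R := sqnorm \o from c.

Lemma sqnorm_differentiable y : cod c y -> differentiable s y.
Proof. by move=> cy; apply: differentiable_dot; exact: immersion_differentiable. Qed.

Lemma derive_sqnorm y v : cod c y -> 'D_v s y = 2 * dot ('D_v Y y) (Y y).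
Proof.
move=> cy; have [_ ->] := is_derive_dot (dY cy v) (dY cy v).
by rewrite [X in _ + X]dotC -/Y; ring.
Qed.

Lemma derive_sqnorm_differentiable y v : cod c y ->
  differentiable (fun z => 'D_v s z) y.
Proof.
move=> cy; have E : \forall z \near y, 'D_v s z = (2 *: (fun z => dot ('D_v Y z) (Y z))) z.
  have := @open_cod _ _ _ c; rewrite openE => /(_ y cy); apply: filterS => z cz.
  by rewrite derive_sqnorm.
apply: near_eq_differentiable E _; apply: differentiableZ.
apply: differentiable_dot; first exact: immersion_differentiable1.
exact: immersion_differentiable.
Qed.

Lemma partial2_sqnorm i j : partial i (partial j s) x =
  2 * (dot (S i j) (Y x) + (T *m T^T) i j).
Proof.
have E : \forall y \near x, partial j s y = (2 *: (fun z => dot (partial j Y z) (Y z))) y.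
  by apply: filterS near_cod => y cy; rewrite /partial derive_sqnorm.
rewrite {1}/partial (near_eq_derive _ E).
have [dd D] := is_derive_dot (d1Y cx (delta_mx 0 i) (delta_mx 0 j)) (dY cx (delta_mx 0 i)).
rewrite deriveZ // D; congr (_ * (_ + _)).
by rewrite dotC -metricE // metric_entryE.
Qed.

(** By the Gauss formula the covariant Hessian of [s] is twice the sum of the second fundamental
    form paired with [X] and the metric; the trace of the metric is [n]. *)
Lemma laplacian_sqnorm :
  laplacian c sqnorm x = 2 * (n%:R + dot (mean_curvature X c x) (Y x)).
Proof.
have E i j : partial i (partial j s) x - \sum_(k < n) christoffel c k i j x * partial k s x
    = 2 * (dot (second_fundamental_form X c x i j) (Y x) + (T *m T^T) i j).
  rewrite partial2_sqnorm gauss_formula dotBl dot_suml.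
  have -> : \sum_(k < n) christoffel c k i j x * partial k s x =
    2 * \sum_(k < n) dot (christoffel c k i j x *: partial k Y x) (Y x).
    rewrite mulr_sumr; apply: eq_bigr => k _.
    by rewrite dotZl /partial derive_sqnorm //; ring.
  by ring.
rewrite /laplacian.
under eq_bigr do under eq_bigr do rewrite E.
have -> : n%:R = \sum_(i < n) \sum_(j < n) Gi i j * (T *m T^T) i j.
  have -> : n%:R = \tr (1%:M : 'M[R]_n) by rewrite mxtrace1.
  rewrite -(mulVmx (gram_unit tangent_frame_free)) -metricE // -/(metric_inv c x) -/Gi.
  rewrite /mxtrace; apply: eq_bigr => i _; rewrite mxE; apply: eq_bigr => j _.
  by rewrite metricE // gram_sym.
rewrite dot_suml mulrDr !mulr_sumr -big_split /=; apply: eq_bigr => i _.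
rewrite dot_suml !mulr_sumr -big_split /=; apply: eq_bigr => j _.
by rewrite dotZl -/Gi; ring.
Qed.

(** The left side is the squared gradient norm of [s], the right side four times the squared norm of
    the tangential part of [X]. *)
Lemma gradient_sqnorm :
  \sum_(i < n) \sum_(j < n) Gi i j * (partial i s x * partial j s x) =
  4 * dot (Y x *m T^T *m Gi *m T) (Y x).
Proof.
have E i : partial i s x = 2 * (Y x *m T^T) 0 i.
  rewrite /partial derive_sqnorm // dotC dotE mxE; congr (_ * _).
  by apply: eq_bigr => a _; rewrite !mxE.
have -> : dot (Y x *m T^T *m Gi *m T) (Y x) = (Y x *m T^T *m Gi *m (Y x *m T^T)^T) 0 0.
  by rewrite /dot trmx_mul trmxK !mulmxA.
rewrite mxE mulr_sumr exchange_big /=; apply: eq_bigr => j _.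
rewrite mxE mulr_suml mulr_sumr; apply: eq_bigr => i _.
by rewrite !E [(_^T) j 0]mxE; ring.
Qed.

End Immersed.

(** * Laplacian comparison and the chain rule *)

Section Comparison.
Variables (R : realType) (n N : nat) (M : riemannian_manifold R n).
Variables (X : M -> 'rV[R]_N) (isoX : isometric_immersion X).
Variables (c : chart R n M) (x : 'rV[R]_n) (atc : atlas c) (cx : cod c x).

Lemma metric_inv_gram : exists B : 'M[R]_(n, N), metric_inv c x = B *m B^T.
Proof.
exists (metric_inv c x *m tangent_frame X c x).
by rewrite /metric_inv (metricE isoX atc cx) -gram_invE // (tangent_frame_free isoX).
Qed.

(** At a local maximum of [u - h] the gradients agree, so the Christoffel terms cancel and the
    difference of the Laplacians is the metric trace of the coordinate Hessian of [u - h]. *)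
Lemma laplacian_le_at_local_max (u h : M -> R) :
  (\forall y \near x, u (from c y) - h (from c y) <= u (from c x) - h (from c x)) ->
  (\forall y \near x, differentiable (u \o from c) y) ->
  (\forall y \near x, differentiable (h \o from c) y) ->
  (forall j, differentiable (partial j (u \o from c)) x) ->
  (forall j, differentiable (partial j (h \o from c)) x) ->
  laplacian c u x <= laplacian c h x.
Proof.
move=> uh du dh ddu ddh.
pose w : 'rV[R]_n -> R := (u \o from c) - (h \o from c).
have wx : \forall y \near x, w y <= w x by [].
have dw : \forall y \near x, differentiable w y.
  by apply: filterS2 du dh => y; exact: differentiableB.
have pw j : \forall y \near x, partial j w y =
    (partial j (u \o from c) - partial j (h \o from c)) y.
  by apply: filterS2 du dh => y duy dhy; apply: deriveB; exact: diff_derivable.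
have ddw j : differentiable (partial j w) x.
  by apply: near_eq_differentiable (pw j) _; exact: differentiableB.
have ppw i j : partial i (partial j w) x =
    partial i (partial j (u \o from c)) x - partial i (partial j (h \o from c)) x.
  rewrite {1}/partial (near_eq_derive _ (pw j)) deriveB //; exact: diff_derivable.
have [B BE] := metric_inv_gram.
have := local_max_trace_hessian B wx dw ddw; rewrite -BE => trace_le0.
rewrite -subr_le0; apply: le_trans trace_le0; rewrite le_eqVlt; apply/orP; left.
rewrite /laplacian -sumrB; apply/eqP; apply: eq_bigr => i _.
rewrite -sumrB; apply: eq_bigr => j _; rewrite -mulrBr ppw; congr (_ * _).
have grad0 k : partial k (u \o from c) x = partial k (h \o from c) x.
  apply/eqP; rewrite -subr_eq0 -(local_max_partial wx dw (ddw k)).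
  by rewrite (nbhs_singleton (pw k)).
under eq_bigr do rewrite grad0.
by rewrite opprB addrA subrK.
Qed.

Let scale_add_alg (a b d e f g : R) :
  e = f * b -> a *: d + g *: e = a * d + f * (b * g).
Proof. by move=> ->; rewrite -![_ *: _]/(_ * _); ring. Qed.

Let laplacian_alg (g a b p q r : R) :
  g * (a * p + b * q - a * r) = a * (g * (p - r)) + b * (g * q).
Proof. by ring. Qed.

(** The derivatives are required only for [0 <= t], which covers all values of [sqnorm X] and suits
    functions singular at [t = -1]. *)
Lemma laplacian_comp_sqnorm (F F1 F2 : R -> R) :
  (forall t : R, 0 <= t -> is_derive t 1 F (F1 t)) ->
  (forall t : R, 0 <= t -> is_derive t 1 F1 (F2 t)) ->
  [/\ forall y, cod c y -> differentiable (F \o sqnorm X \o from c) y,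
      forall j, differentiable (partial j (F \o sqnorm X \o from c)) x &
      laplacian c (F \o sqnorm X) x =
        F1 (sqnorm X (from c x)) * laplacian c (sqnorm X) x +
        F2 (sqnorm X (from c x)) *
        \sum_(i < n) \sum_(j < n) metric_inv c x i j *
          (partial i (sqnorm X \o from c) x * partial j (sqnorm X \o from c) x)].
Proof.
move=> dF dF1.
pose s : 'rV[R]_n -> R := sqnorm X \o from c.
have s0 y : 0 <= s y by exact: dot_ge0.
have ds y : cod c y -> differentiable s y by exact: sqnorm_differentiable.
have FE (G G1 : R -> R) y v : (forall t : R, 0 <= t -> is_derive t 1 G (G1 t)) -> cod c y ->
    differentiable (G \o s) y /\ 'D_v (G \o s) y = G1 (s y) * 'D_v s y.
  move=> dG cy; have [Gd <-] := dG _ (s0 y).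
  exact: derive_comp1 (ds _ cy) Gd.
have pF j : \forall y \near x, partial j (F \o s) y = ((F1 \o s) * partial j s) y.
  by apply: filterS (near_cod cx) => y cy; have [_] := FE _ _ y (delta_mx 0 j) dF cy.
have dps j : differentiable (partial j s) x.
  exact: (derive_sqnorm_differentiable isoX).
(* Only the differentiability of [F1 \o s] is extracted, so any direction would do. *)
have [dF1s _] := FE _ _ x 0 dF1 cx.
split.
- by move=> y cy; have [] := FE _ _ y 0 dF cy.
- by move=> j; apply: near_eq_differentiable (pF j) _; exact: differentiableM.
have ppF i j : partial i (partial j (F \o s)) x =
    F1 (s x) * partial i (partial j s) x + F2 (s x) * (partial i s x * partial j s x).
  rewrite {1}/partial (near_eq_derive _ (pF j)) deriveM; last 2 first.
  - exact: diff_derivable.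
  - exact: diff_derivable.
  have [_ Ei] := FE _ _ x (delta_mx 0 i) dF1 cx.
  by apply: scale_add_alg; rewrite Ei.
rewrite /laplacian !mulr_sumr -big_split /=; apply: eq_bigr => i _.
rewrite !mulr_sumr -big_split /=; apply: eq_bigr => j _.
rewrite -[F \o _ \o _]/(F \o s) ppF -/s.
under eq_bigr do rewrite (nbhs_singleton (pF _)).
have -> : \sum_(k < n) christoffel c k i j x * ((F1 \o s) * partial k s) x =
   F1 (s x) * \sum_(k < n) christoffel c k i j x * partial k s x.
  rewrite mulr_sumr; apply: eq_bigr => k _.
  by rewrite mulrCA.
rewrite -[sqnorm X (from c x)]/(s x) .
exact: laplacian_alg.
Qed.

End Comparison.

(** * The subharmonic function *)

Section InverseSqrt.
Variable R : realType.

(** With [r] this function, [r' = - r^3 / 2]. Derivatives are kept as powers of [r], so that with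
    [r^2 * (1 + t) = 1] the final estimate is polynomial. *)
Definition inv_sqrt1 (t : R) : R := (Num.sqrt (1 + t))^-1.

Lemma inv_sqrt1_gt0 (t : R) : 0 <= t -> 0 < inv_sqrt1 t.
Proof. by move=> t0; rewrite invr_gt0 sqrtr_gt0; lra. Qed.

Lemma inv_sqrt1_sqr (t : R) : 0 <= t -> inv_sqrt1 t ^+ 2 * (1 + t) = 1.
Proof.
move=> t0; rewrite exprVn sqr_sqrtr ?mulVf //; first by rewrite gt_eqF //; lra.
by lra.
Qed.

Lemma is_derive_inv_sqrt1 (t : R) : 0 <= t ->
  is_derive t 1 inv_sqrt1 (- (2^-1 * inv_sqrt1 t ^+ 3)).
Proof.
move=> t0; have t1 : 0 < 1 + t by lra.
have sq0 : Num.sqrt (1 + t) != 0 by rewrite gt_eqF // sqrtr_gt0.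
pose g : R -> R := cst 1 + id.
have dg : is_derive t 1 g 1 by apply: is_derive_eq; rewrite add0r.
have [ds Ds] := is_derive1_sqrt t1.
have [dg1 Dg1] := dg.
have [dsg Dsg] := @derive_comp1 R R Num.sqrt g t 1
  ((derivable1_diffP _ _).1 dg1) ds.
have dsg' : is_derive t 1 (Num.sqrt \o g) (2 * Num.sqrt (1 + t))^-1.
  split; first exact: diff_derivable.
  by rewrite Dsg Dg1 mulr1.
have gt0 : (Num.sqrt \o g) t != 0 by [].
apply: (is_derive_eq (is_deriveV gt0 dsg')).
rewrite /inv_sqrt1 -[_ *: _]/(_ * _) /=.
by move: (Num.sqrt _) sq0 => r r0; field.
Qed.

Lemma is_derive_Ninv_sqrt1 (t : R) : 0 <= t ->
  is_derive t 1 (- inv_sqrt1) (2^-1 * inv_sqrt1 t ^+ 3).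
Proof.
by move=> /is_derive_inv_sqrt1 d; apply: (is_derive_eq (is_deriveN d)); rewrite opprK.
Qed.

Lemma is_derive_inv_sqrt1X3 (t : R) : 0 <= t ->
  is_derive t 1 (fun t => 2^-1 * inv_sqrt1 t ^+ 3) (- (3 / 4 * inv_sqrt1 t ^+ 5)).
Proof.
move=> /is_derive_inv_sqrt1 d.
have := is_deriveZ 2^-1 (is_deriveX 3 d).
have -> : 2^-1 \*: inv_sqrt1 ^+ 3 = (fun t => 2^-1 * inv_sqrt1 t ^+ 3).
  by apply/funext.
move=> H; apply: (is_derive_eq H).
by rewrite -![_ *: _]/(_ * _) /=; field.
Qed.

End InverseSqrt.

(** * Constants as harmonic functions *)

Lemma class_C_cst (R : realType) (n : nat) (W : normedModType R) (k : nat)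
  (U : set 'rV[R]_n) (a : W) : class_C k U (cst a).
Proof.
(* The value [a] must vary in the induction, since differentiation replaces it by 0. *)
elim: k a => [|k IH] a /=; first by move=> x _; exact: cst_continuous.
split=> [x _|v]; first exact: differentiable_cst.
have -> : (fun x => 'D_v (cst a) x) = cst (0 : W) by apply/funext => x; exact: derive_cst.
exact: IH.
Qed.

Lemma harmonic_on_cst (R : realType) (n : nat) (M : riemannian_manifold R n)
  (O : set M) (a : R) : harmonic_on O (cst a).
Proof.
move=> c _; split=> [|x _ _]; first exact: (@class_C_cst R n R 2 _ a).
have p0 b j : partial j (cst b : 'rV[R]_n -> R) = cst 0.
  by apply/funext => y; exact: derive_cst.
rewrite /laplacian -[cst a \o from c]/(cst a) big1 // => i _; rewrite big1 // => j _.
by rewrite !p0 big1 ?subrr ?mulr0 // => k _; rewrite p0 mulr0.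
Qed.

(** * The barrier on a soliton *)

Section Soliton.
Variables (R : realType) (n N : nat) (M : riemannian_manifold R n).
Variables (X : M -> 'rV[R]_N) (lambda : R).
Hypotheses (n_gt2 : (2 < n)%N) (solX : mcf_soliton X lambda) (lambda_le0 : lambda <= 0).

Let isoX : isometric_immersion X. Proof. by case: solX. Qed.

Definition barrier : M -> R := (- @inv_sqrt1 R) \o sqnorm X.

Section Chart.
Variables (c : chart R n M) (x : 'rV[R]_n) (atc : atlas c) (cx : cod c x).

(** The bound is [2 * 3], from [n >= 3]; the soliton equation adds [- 2 * lambda] times the squared
    normal part, which is nonnegative. *)
Lemma laplacian_sqnorm_ge : 6 <= laplacian c (sqnorm X) x.
Proof.
rewrite (laplacian_sqnorm isoX) //; case: solX => _ _ -> //.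
rewrite (normal_partE isoX) // dotZl.
have p0 := dot_normal (tangent_frame_free isoX atc cx) (X (from c x)).
rewrite /metric_inv (metricE isoX) // p0.
have n3 : (3 : R) <= n%:R by rewrite ler_nat.
set p := dot _ _; have : 0 <= - lambda * p by rewrite mulr_ge0 ?oppr_ge0 ?dot_ge0.
by lra.
Qed.

(** The deficit is four times the squared norm of the normal part of [X]. *)
Lemma gradient_sqnorm_le :
  \sum_(i < n) \sum_(j < n) metric_inv c x i j *
     (partial i (sqnorm X \o from c) x * partial j (sqnorm X \o from c) x) <=
  4 * sqnorm X (from c x).
Proof.
rewrite (gradient_sqnorm isoX) // ler_pM2l //.
have := dot_normal (tangent_frame_free isoX atc cx) (X (from c x)).
rewrite /= dotBl /metric_inv (metricE isoX) // => E.
by rewrite /sqnorm -subr_ge0 E dot_ge0.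
Qed.

Lemma barrier_regular :
  (forall y, cod c y -> differentiable (barrier \o from c) y) /\
  (forall j, differentiable (partial j (barrier \o from c)) x).
Proof.
by have [] := laplacian_comp_sqnorm isoX atc cx
  (@is_derive_Ninv_sqrt1 R) (@is_derive_inv_sqrt1X3 R).
Qed.

Lemma laplacian_barrier_gt0 : 0 < laplacian c barrier x.
Proof.
have [_ _ ->] := laplacian_comp_sqnorm isoX atc cx
  (@is_derive_Ninv_sqrt1 R) (@is_derive_inv_sqrt1X3 R).
move: laplacian_sqnorm_ge gradient_sqnorm_le.
have s0 : 0 <= sqnorm X (from c x) by exact: dot_ge0.
move: (laplacian c _ x) (\sum_(i < n) _) (sqnorm X _) s0 => L D s s0 L6 D4.
have r0 := inv_sqrt1_gt0 s0; have r2 := inv_sqrt1_sqr s0.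
move: (inv_sqrt1 s) r0 r2 => r r0 r2.
have r3 : 0 < r ^+ 3 by rewrite exprn_gt0.
have r5 : 0 < r ^+ 5 by rewrite exprn_gt0.
(* [h1] and [h2] allow replacing [L] by 6 and [D] by [4 * s]; by [h3] the resulting lower bound
   [3 * r^3 - 3 * r^5 * s] equals [3 * r^5]. *)
have h1 : 0 <= r ^+ 3 * (L - 6) by rewrite mulr_ge0 ?subr_ge0 // ltW.
have h2 : 0 <= r ^+ 5 * (4 * s - D) by rewrite mulr_ge0 ?subr_ge0 // ltW.
have h3 : r ^+ 3 = r ^+ 5 + r ^+ 5 * s by rewrite -[LHS]mulr1 -r2; ring.
by nra.
Qed.

End Chart.

Lemma barrier_continuous : continuous barrier.
Proof.
move=> p; have [c atc cp] := atlas_cover p.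
have cx := to_cod cp.
have dv : {for to c p, continuous (barrier \o from c)}.
  by apply: differentiable_continuous; apply: (barrier_regular atc cx).1.
have dom_near : \forall q \near p, dom c q.
  by have := @open_dom _ _ _ c; rewrite openE => /(_ p cp).
(* Continuity passes through the chart: near [p] the barrier equals this composite, by [toK]. *)
have H : {for p, continuous ((barrier \o from c) \o to c)}.
  by apply: continuous_comp => //; exact: to_continuous.
have E : \forall q \near p, ((barrier \o from c) \o to c) q = barrier q.
  by apply: filterS dom_near => q cq /=; rewrite toK.
rewrite /continuous_at -(nbhs_singleton E).
by apply: cvg_trans H; apply: near_eq_cvg; apply: filterS E => q ->.
Qed.

(** A maximum over the open set [O] is a local maximum in a chart, where the Laplacian of the
    barrier would be both positive and at most that of [h], which is 0. *)
Lemma barrier_no_interior_max (O : set M) (h : M -> R) (p : M) :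
  open O -> harmonic_on O h -> O p ->
  ~ (forall q, O q -> barrier q - h q <= barrier p - h p).
Proof.
move=> oO hh Op pmax; have [c atc cp] := atlas_cover p.
pose x := to c p; have cx : cod c x by exact: to_cod.
have xp : from c x = p by exact: toK.
have Oz z : cod c z -> O (from c z) -> \forall y \near z, cod c y /\ O (from c y).
  move=> cz Oz; apply: filterI; first exact: (near_cod cz).
  apply: (from_continuous cz); rewrite nbhsE; by exists O.
have Ox : \forall y \near x, cod c y /\ O (from c y) by apply: Oz => //; rewrite xp.
have [[dh ddh] lap0] := hh c atc.
have L0 : laplacian c h x = 0 by apply: lap0 => //; rewrite xp.
have [db ddb] := barrier_regular atc cx.
have : laplacian c barrier x <= laplacian c h x.
  apply: (laplacian_le_at_local_max isoX atc cx) => //.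
  - by apply: filterS Ox => y [_ Oy]; rewrite xp; exact: pmax.
  - by apply: filterS Ox => y [cy _]; exact: db.
  - by apply: filterS Ox => y; exact: dh.
  - by move=> j; apply: (ddh _).1; split => //=; rewrite xp.
by rewrite L0 leNgt laplacian_barrier_gt0.
Qed.

Lemma barrier_subharmonic : subharmonic barrier.
Proof.
split; first exact: barrier_continuous.
move=> O h oO _ cO [b0 b0b] ch hh bdry.
have cbh : {within closure O, continuous (barrier - h)}.
  move=> y; apply: continuousB; last exact: ch.
  by apply: continuous_subspaceT; exact: barrier_continuous.
(* The boundary point [b0] shows that [closure O] is nonempty, so the maximum is attained at some
   [m]. *)
have [|m] := compact_EVT_max _ cO cbh; first by exists b0; case: b0b.
rewrite inE => mO mmax p Op.
have le_m q : O q -> barrier q - h q <= barrier m - h m.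
  by move=> Oq; apply: mmax; rewrite inE; exact: subset_closure.
rewrite -subr_le0; apply: le_trans (le_m p Op) _.
(* An interior [m] is excluded by the Laplacian argument; otherwise [m] is a boundary point and
   [bdry] applies. *)
have [Om|nOm] := pselect (O m).
  by have := barrier_no_interior_max oO hh Om le_m.
by rewrite subr_le0 bdry.
Qed.

Lemma barrier_le0 p : barrier p <= 0.
Proof. by rewrite oppr_le0 ltW // inv_sqrt1_gt0 // dot_ge0. Qed.

(** For a constant barrier every point would be a maximum over all of [M] of its difference with the
    harmonic function 0. *)
Lemma barrier_nonconstant a : ~ (forall p, barrier p = a).
Proof.
move=> ba; have [p _] := mfd_nonempty M.
have pT : [set: M] p by [].
apply: (barrier_no_interior_max openT (harmonic_on_cst setT 0) pT) => q _.
by rewrite !ba.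
Qed.

Lemma soliton_non_parabolic : non_parabolic M.
Proof.
move=> /(_ _ barrier_subharmonic)[|a ba]; last exact: barrier_nonconstant ba.
by exists 0 => p; exact: barrier_le0.
Qed.

End Soliton.

Theorem corollary3p3 (R : realType) (n m : nat) (hn : (2 < n)%N)
    (hm : (1 <= m)%N) (Sigma : riemannian_manifold R n)
    (X : Sigma -> 'rV[R]_(n + m)) (lambda : R)
    (hX : mcf_soliton X lambda) (hlambda : lambda <= 0) :
  non_parabolic Sigma.
Proof. exact: soliton_non_parabolic hn hX hlambda. Qed.
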